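(* Let $(\mathfrak g,[\cdot,\cdot]_{\mathfrak g},[\![\cdot,\cdot,\cdot]\!]_{\mathfrak g})$ and $(\mathfrak h,[\cdot,\cdot]_{\mathfrak h},[\![\cdot,\cdot,\cdot]\!]_{\mathfrak h})$ be two Lie-Yamaguti algebras, $(\rho,\mu)$ an action of $\mathfrak g$ on $\mathfrak h$, and $H:\mathfrak g\to\mathfrak h$ a crossed homomorphism with respect to $(\rho,\mu)$. Define $\delta:\wedge^2\mathfrak g\to\mathrm{Hom}(\mathfrak g,\mathfrak h)$ by $$\big(\delta(x,y)\big)z:=\mu(y,z)(Hx)-\mu(x,z)(Hy)+[\![Hx,Hy,Hz]\!]_{\mathfrak h},\qquad x,y,z\in\mathfrak g.$$ Then for all $x,y\in\mathfrak g$, $\delta(x,y)$ is a $1$-cocycle of the Lie-Yamaguti algebra $\mathfrak g$ with coefficients in the representation $(\mathfrak h;\rho_H,\mu_H)$.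
   Context: All vector spaces are finite-dimensional over a field $\mathbb K$ of characteristic $0$. A Lie-Yamaguti algebra is a vector space $\mathfrak g$ with a bilinear bracket $[\cdot,\cdot]:\wedge^2\mathfrak g\to\mathfrak g$ and a trilinear bracket $[\![\cdot,\cdot,\cdot]\!]:\wedge^2\mathfrak g\otimes\mathfrak g\to\mathfrak g$ (skew-symmetric in the first two arguments) such that for all $x,y,z,w,t\in\mathfrak g$: (1) $[[x,y],z]+[[y,z],x]+[[z,x],y]+[\![x,y,z]\!]+[\![y,z,x]\!]+[\![z,x,y]\!]=0$; (2) $[\![[x,y],z,w]\!]+[\![[y,z],x,w]\!]+[\![[z,x],y,w]\!]=0$; (3) $[\![x,y,[z,w]]\!]=[[\![x,y,z]\!],w]+[z,[\![x,y,w]\!]]$; (4) $[\![x,y,[\![z,w,t]\!]]\!]=[\![[\![x,y,z]\!],w,t]\!]+[\![z,[\![x,y,w]\!],t]\!]+[\![z,w,[\![x,y,t]\!]]\!]$. A representation of $\mathfrak g$ on a vector space $V$ is a linear map $\rho:\mathfrak g\to\mathfrak{gl}(V)$ and a bilinear map $\mu:\otimes^2\mathfrak g\to\mathfrak{gl}(V)$ such that, with $D(x,y)=D_{\rho,\mu}(x,y):=\mu(y,x)-\mu(x,y)+[\rho(x),\rho(y)]-\rho([x,y])$, for all $x,y,z,w\in\mathfrak g$: $\mu([x,y],z)-\mu(x,z)\rho(y)+\mu(y,z)\rho(x)=0$; $\mu(x,[y,z])-\rho(y)\mu(x,z)+\rho(z)\mu(x,y)=0$; $\rho([\![x,y,z]\!])=[D(x,y),\rho(z)]$;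 $\mu(z,w)\mu(x,y)-\mu(y,w)\mu(x,z)-\mu(x,[\![y,z,w]\!])+D(y,z)\mu(x,w)=0$; $\mu([\![x,y,z]\!],w)+\mu(z,[\![x,y,w]\!])=[D(x,y),\mu(z,w)]$. The center of $\mathfrak h$ is $C(\mathfrak h):=\{u:[u,v]=0\ \forall v\}\cap\big(\{u:[\![u,v,w]\!]=0\ \forall v,w\}\cup\{u:[\![v,u,w]\!]=0\ \forall v,w\}\big)$. An action of $\mathfrak g$ on $\mathfrak h$ is a representation $(\rho,\mu)$ of $\mathfrak g$ on the vector space $\mathfrak h$ such that for all $x,y\in\mathfrak g$, $u,v,w\in\mathfrak h$: $\rho(x)u,\ \mu(x,y)u\in C(\mathfrak h)$; $\rho(x)[u,v]_{\mathfrak h}=\mu(x,y)[u,v]_{\mathfrak h}=0$; $\rho(x)[\![u,v,w]\!]_{\mathfrak h}=\mu(x,y)[\![u,v,w]\!]_{\mathfrak h}=0$. A crossed homomorphism from $\mathfrak g$ to $\mathfrak h$ with respect to an action $(\rho,\mu)$ is a linear map $H:\mathfrak g\to\mathfrak h$ such that for all $x,y,z\in\mathfrak g$: $H[x,y]_{\mathfrak g}=\rho(x)H(y)-\rho(y)H(x)+[Hx,Hy]_{\mathfrak h}$ and $H[\![x,y,z]\!]_{\mathfrak g}=D(x,y)H(z)+\mu(y,z)H(x)-\mu(x,z)H(y)+[\![Hx,Hy,Hz]\!]_{\mathfrak h}$. The representation $(\mathfrak h;\rho_H,\mu_H)$ of $\mathfrak g$ is given by $\rho_H(x)u=[Hx,u]_{\mathfrak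 h}+\rho(x)u$, $\mu_H(x,y)u=[\![u,Hx,Hy]\!]_{\mathfrak h}+\mu(x,y)u$, and one has $D_H(x,y)u:=D_{\rho_H,\mu_H}(x,y)u=[\![Hx,Hy,u]\!]_{\mathfrak h}+D(x,y)u$. A linear map $f\in\mathrm{Hom}(\mathfrak g,\mathfrak h)$ is a $1$-cocycle with coefficients in $(\mathfrak h;\rho_H,\mu_H)$ if for all $a,b,c\in\mathfrak g$: $\rho_H(a)f(b)-\rho_H(b)f(a)-f([a,b]_{\mathfrak g})=0$ and $D_H(a,b)f(c)+\mu_H(b,c)f(a)-\mu_H(a,c)f(b)-f([\![a,b,c]\!]_{\mathfrak g})=0$. *)

(* Defs.v *)
From HB Require Import structures.
From mathcomp Require Import all_boot all_order all_algebra.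

Set Implicit Arguments.
Unset Strict Implicit.
Unset Printing Implicit Defensive.

Import GRing.Theory.
Local Open Scope ring_scope.

(* As with linfun, the value is meaningful only when f is linear in each
   argument: see lcurry2E and lcurry3E. *)
Definition lcurry2 (K : fieldType) (U V W : vectType K) (f : U -> V -> W) :
    'Hom(U, 'Hom(V, W)) :=
  linfun (fun x => linfun (f x)).

Definition lcurry3 (K : fieldType) (U V W T : vectType K)
    (f : U -> V -> W -> T) : 'Hom(U, 'Hom(V, 'Hom(W, T))) :=
  linfun (fun x => lcurry2 (f x)).

Lemma linfunE (K : fieldType) (U V : vectType K) (f : U -> V) (x : U) :
  linear f -> linfun f x = f x.
Proof.
move=> fL; pose fM := GRing.isLinear.Build K U V *:%R f fL.
pose g : {linear U -> V} := HB.pack f fM.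
exact: (lfunE g).
Qed.

Lemma lcurry2E (K : fieldType) (U V W : vectType K) (f : U -> V -> W) :
    (forall x, linear (f x)) -> (forall y, linear (f^~ y)) ->
  forall x y, lcurry2 f x y = f x y.
Proof.
move=> fr fl x y; rewrite /lcurry2 (@linfunE _ _ _ (fun x => linfun (f x))).
  by rewrite linfunE.
move=> k a b; apply/lfunP => z; rewrite add_lfunE scale_lfunE !linfunE //.
exact: fl.
Qed.

Lemma lcurry3E (K : fieldType) (U V W T : vectType K)
    (f : U -> V -> W -> T) :
    (forall x y, linear (f x y)) -> (forall x z, linear (fun y => f x y z)) ->
    (forall y z, linear (fun x => f x y z)) ->
  forall x y z, lcurry3 f x y z = f x y z.
Proof.
move=> f3 f2 f1 x y z.
rewrite /lcurry3 (@linfunE _ _ _ (fun x => lcurry2 (f x))); first exact: lcurry2E.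
move=> k a b; apply/lfunP => v; apply/lfunP => w.
by rewrite !(add_lfunE, scale_lfunE) !lcurry2E //; exact: f1.
Qed.

HB.mixin Record Vector_isLieYamaguti (K : fieldType) g of Vector K g := {
  lybr2 : 'Hom(g, 'Hom(g, g));
  lybr3 : 'Hom(g, 'Hom(g, 'Hom(g, g)));
  lybr2_skew : forall x y : g, lybr2 x y = - lybr2 y x;
  lybr3_skew : forall x y z : g, lybr3 x y z = - lybr3 y x z;
  lybr_cyclic : forall x y z : g,
    lybr2 (lybr2 x y) z + lybr2 (lybr2 y z) x + lybr2 (lybr2 z x) y
    + lybr3 x y z + lybr3 y z x + lybr3 z x y = 0;
  lybr32_cyclic : forall x y z w : g,
    lybr3 (lybr2 x y) z w + lybr3 (lybr2 y z) x w
    + lybr3 (lybr2 z x) y w = 0;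
  lybr3_der2 : forall x y z w : g,
    lybr3 x y (lybr2 z w) = lybr2 (lybr3 x y z) w + lybr2 z (lybr3 x y w);
  lybr3_der3 : forall x y z w t : g,
    lybr3 x y (lybr3 z w t) =
      lybr3 (lybr3 x y z) w t + lybr3 z (lybr3 x y w) t
      + lybr3 z w (lybr3 x y t) }.

#[short(type="lieYamagutiType")]
HB.structure Definition LieYamaguti (K : fieldType) :=
  { g of Vector K g & Vector_isLieYamaguti K g }.

Notation "[ly x , y ]" := (lybr2 x y)
  (at level 0, x, y at level 99, format "[ly  x ,  y ]") : ring_scope.
Notation "[ly x , y , z ]" := (lybr3 x y z)
  (at level 0, x, y, z at level 99,
   format "[ly  x ,  y ,  z ]") : ring_scope.

Definition commlf (K : fieldType) (V : vectType K) (f g : 'End(V)) : 'End(V) :=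
  (f \o g)%VF - (g \o f)%VF.

Section Representation.
Variables (K : fieldType) (g : lieYamagutiType K) (V : vectType K).
Variables (rho : 'Hom(g, 'End(V))) (mu : 'Hom(g, 'Hom(g, 'End(V)))).

Definition repD (x y : g) : 'End(V) :=
  mu y x - mu x y + commlf (rho x) (rho y) - rho [ly x, y].

Record is_representation : Prop := IsRepresentation {
  rep_mu2l : forall x y z : g,
    mu [ly x, y] z - (mu x z \o rho y)%VF + (mu y z \o rho x)%VF = 0;
  rep_mu2r : forall x y z : g,
    mu x [ly y, z] - (rho y \o mu x z)%VF + (rho z \o mu x y)%VF = 0;
  rep_rho3 : forall x y z : g, rho [ly x, y, z] = commlf (repD x y) (rho z);
  rep_mu3r : forall x y z w : g,
    (mu z w \o mu x y)%VF - (mu y w \o mu x z)%VF - mu x [ly y, z, w]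
    + (repD y z \o mu x w)%VF = 0;
  rep_mu3 : forall x y z w : g,
    mu [ly x, y, z] w + mu z [ly x, y, w] = commlf (repD x y) (mu z w) }.

Definition is_1cocycle (f : 'Hom(g, V)) : Prop :=
  (forall a b : g, rho a (f b) - rho b (f a) - f [ly a, b] = 0) /\
  (forall a b c : g,
     repD a b (f c) + mu b c (f a) - mu a c (f b) - f [ly a, b, c] = 0).
End Representation.

Definition central (K : fieldType) (h : lieYamagutiType K) (u : h) : Prop :=
  (forall v : h, [ly u, v] = 0) /\
  ((forall v w : h, [ly u, v, w] = 0) \/ (forall v w : h, [ly v, u, w] = 0)).

Section CrossedHom.
Variables (K : fieldType) (g h : lieYamagutiType K).
Variables (rho : 'Hom(g, 'End(h))) (mu : 'Hom(g, 'Hom(g, 'End(h)))).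

Record is_action : Prop := IsAction {
  action_rep : is_representation rho mu;
  action_rho_central : forall (x : g) (u : h), central (rho x u);
  action_mu_central : forall (x y : g) (u : h), central (mu x y u);
  action_rho2 : forall (x : g) (u v : h), rho x [ly u, v] = 0;
  action_mu2 : forall (x y : g) (u v : h), mu x y [ly u, v] = 0;
  action_rho3 : forall (x : g) (u v w : h), rho x [ly u, v, w] = 0;
  action_mu3 : forall (x y : g) (u v w : h), mu x y [ly u, v, w] = 0 }.

Variable H : 'Hom(g, h).

Definition is_crossed_hom : Prop :=
  (forall x y : g,
     H [ly x, y] = rho x (H y) - rho y (H x) + [ly H x, H y]) /\
  (forall x y z : g,
     H [ly x, y, z] = repD rho mu x y (H z) + mu y z (H x) - mu x z (H y)
                      + [ly H x, H y, H z]).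

Definition rhoH : 'Hom(g, 'End(h)) :=
  lcurry2 (fun x u => [ly H x, u] + rho x u).

Definition muH : 'Hom(g, 'Hom(g, 'End(h))) :=
  lcurry3 (fun x y u => [ly u, H x, H y] + mu x y u).

Definition delta : 'Hom(g, 'Hom(g, 'Hom(g, h))) :=
  lcurry3 (fun x y z => mu y z (H x) - mu x z (H y) + [ly H x, H y, H z]).

Lemma rhoHE x u : rhoH x u = [ly H x, u] + rho x u.
Proof.
rewrite /rhoH lcurry2E // => *; move=> k a b;
by rewrite !(linearP, add_lfunE, scale_lfunE) scalerDr addrACA.
Qed.

Lemma muHE x y u : muH x y u = [ly u, H x, H y] + mu x y u.
Proof.
rewrite /muH lcurry3E // => *; move=> k a b;
by rewrite !(linearP, add_lfunE, scale_lfunE) scalerDr addrACA.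
Qed.

Lemma deltaE x y z :
  delta x y z = mu y z (H x) - mu x z (H y) + [ly H x, H y, H z].
Proof.
have lin (k : K) (a b c a' b' c' : h) :
    k *: a + a' + (k *: b + b') + (k *: c + c')
    = k *: (a + b + c) + (a' + b' + c').
  by rewrite !scalerDr [k *: a + a' + _]addrACA [LHS]addrACA.
rewrite /delta lcurry3E // => *; move=> k a b;
by rewrite !(linearP, add_lfunE, scale_lfunE) lin.
Qed.

Lemma delta_skew x y : delta x y = - delta y x.
Proof.
apply/lfunP => z; rewrite opp_lfunE !deltaE lybr3_skew.
by rewrite opprD opprB.
Qed.
End CrossedHom.

(* Main.v *)
Require Import Defs.
From HB Require Import structures.
From mathcomp Require Import all_boot all_order all_algebra.
From mathcomp Require Import ring.

Set Implicit Arguments.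
Unset Strict Implicit.
Unset Printing Implicit Defensive.

Import GRing.Theory.
Local Open Scope ring_scope.

(** Write [L(x,y) = [ly x, y, _]] and [D = repD rho mu].  The ternary equation
    of a crossed homomorphism says exactly that
    [delta(x,y) = H \o L(x,y) - D(x,y) \o H].

    The pair [(L(x,y), D(x,y))] is an infinitesimal symmetry of everything
    that enters the crossed homomorphism equations: [L(x,y)] is a derivation of
    [g] (two of the Lie-Yamaguti axioms); the representation axioms say that
    bracketing [rho], [mu] with [D(x,y)] amounts to moving their arguments by
    [L(x,y)], and the same then holds for [D] itself ([repD_symmetry]); and
    [D(x,y)] is a derivation of [h] for the trivial reason that every term of
    the Leibniz rule vanishes: it kills brackets and takes central values
    ([action_repD2], [action_repD3], [action_repD_central]).

    Moving [H] along an infinitesimal symmetry stays, to first order, among the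
    crossed homomorphisms.  So [H \o L - D \o H] solves the equations linearised
    at [H] ([infinitesimal_symmetry_eq2], [infinitesimal_symmetry_eq3]), and
    these are the 1-cocycle equations for [(rhoH, muH)], once [repD] of that
    pair has been computed ([repD_rhoH_muH]). *)

(** * Linear identities *)

Section Linearity.
Variables (K : fieldType) (U V : vectType K).

Lemma homD (f : 'Hom(U, V)) u v : f (u + v) = f u + f v.
Proof. exact: linearD. Qed.

Lemma homN (f : 'Hom(U, V)) u : f (- u) = - f u.
Proof. exact: linearN. Qed.

Lemma hom0 (f : 'Hom(U, V)) : f 0 = 0.
Proof. exact: linear0. Qed.

End Linearity.

Local Notation homE := (homD, homN, add_lfunE, opp_lfunE).

Section Coordinates.
Variables (K : fieldType) (V : vectType K).
Implicit Types u v : V.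

Definition coordinate (i : 'I_(\dim {:V})) u : K := coord (vbasis {:V}) i u.

Lemma coordinateP u v : (forall i, coordinate i u = coordinate i v) -> u = v.
Proof.
move=> uv; rewrite (coord_vbasis (memvf u)) (coord_vbasis (memvf v)).
by apply: eq_bigr => i _; rewrite -/(coordinate i u) uv.
Qed.

Lemma coordinateD i u v :
  coordinate i (u + v) = coordinate i u + coordinate i v.
Proof. exact: linearD. Qed.

Lemma coordinateN i u : coordinate i (- u) = - coordinate i u.
Proof. exact: linearN. Qed.

Lemma coordinate0 i : coordinate i 0 = 0.
Proof. exact: linear0. Qed.

End Coordinates.

(** An additive identity in a vector space is checked coordinatewise, where it
    becomes an identity in the ground field.  The values of linear maps are
    generalised first: they are the atoms of the identity. *)
Ltac vring :=
  repeat match goal with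
    |- context [fun_of_lfun ?f ?v] => move: (fun_of_lfun f v) => ?
  end;
  apply: coordinateP => ?;
  rewrite ?(coordinateD, coordinateN, coordinate0); ring.

(** * The centre *)

Section Centre.
Variables (K : fieldType) (h : lieYamagutiType K).
Implicit Types u v w : h.

(** The two ternary conditions offered by [central] are interchanged by
    skew-symmetry. *)
Lemma central_lybr3l u v w : central u -> [ly u, v, w] = 0.
Proof. by case=> _ [] // cu; rewrite lybr3_skew cu oppr0. Qed.

Lemma central_lybr3m u v w : central u -> [ly v, u, w] = 0.
Proof. by move=> cu; rewrite lybr3_skew central_lybr3l ?oppr0. Qed.

Lemma central_lybr2l u v : central u -> [ly u, v] = 0.
Proof. by case. Qed.

Lemma central_lybr2r u v : central u -> [ly v, u] = 0.
Proof. by move=> cu; rewrite lybr2_skew central_lybr2l ?oppr0. Qed.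

(** The last slot is not covered by the definition: all other terms of the
    cyclic identity for [u, v, w] vanish, so this one does too. *)
Lemma central_lybr3r u v w : central u -> [ly v, w, u] = 0.
Proof.
move=> cu; have := lybr_cyclic v w u.
rewrite (central_lybr2r _ cu) (central_lybr2r w cu) (central_lybr2l v cu).
rewrite (central_lybr3m _ _ cu) (central_lybr3l _ _ cu).
by rewrite hom0 !zero_lfunE !(add0r, addr0).
Qed.

Lemma centralD u v : central u -> central v -> central (u + v).
Proof.
move=> cu cv; split=> [w|].
  by rewrite !homE !central_lybr2l ?addr0.
left=> w t.
by rewrite !homE !central_lybr3l ?addr0.
Qed.

Lemma centralN u : central u -> central (- u).
Proof.
move=> cu; split=> [w|].
  by rewrite !homE central_lybr2l ?oppr0.
by left=> w t; rewrite !homE central_lybr3l ?oppr0.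
Qed.

End Centre.

(** * The operators D *)

Lemma repDE (K : fieldType) (g : lieYamagutiType K) (V : vectType K)
    (rho : 'Hom(g, 'End(V))) (mu : 'Hom(g, 'Hom(g, 'End(V)))) x y u :
  repD rho mu x y u = mu y x u - mu x y u
    + (rho x (rho y u) - rho y (rho x u)) - rho [ly x, y] u.
Proof. by rewrite !(add_lfunE, opp_lfunE, comp_lfunE). Qed.

(** [repD] is built from [rho], [mu] and the binary bracket, so it inherits
    every infinitesimal symmetry [(d, E)] of these three. *)
Lemma repD_symmetry (K : fieldType) (g : lieYamagutiType K) (V : vectType K)
    (rho : 'Hom(g, 'End(V))) (mu : 'Hom(g, 'Hom(g, 'End(V))))
    (d : 'End(g)) (E : 'End(V)) :
    (forall a b, d [ly a, b] = [ly d a, b] + [ly a, d b]) ->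
    (forall a u, rho (d a) u = E (rho a u) - rho a (E u)) ->
    (forall a b u, mu (d a) b u + mu a (d b) u
                   = E (mu a b u) - mu a b (E u)) ->
  forall a b u, repD rho mu (d a) b u + repD rho mu a (d b) u
                = E (repD rho mu a b u) - repD rho mu a b (E u).
Proof.
move=> d2 rho_d mu_d a b u.
rewrite (repDE rho mu (d a)) (repDE rho mu a (d b)) 2!(repDE rho mu a b).
rewrite 4!rho_d !homE.
have -> : mu a (d b) u = E (mu a b u) - mu a b (E u) - mu (d a) b u.
  by rewrite -mu_d; vring.
have -> : mu (d b) a u = E (mu b a u) - mu b a (E u) - mu b (d a) u.
  by rewrite -mu_d; vring.
have -> : rho [ly a, d b] u
    = E (rho [ly a, b] u) - rho [ly a, b] (E u) - rho [ly d a, b] u.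
  by rewrite -rho_d d2 !homE; vring.
vring.
Qed.

Section Equivariance.
Variables (K : fieldType) (g : lieYamagutiType K) (V : vectType K).
Variables (rho : 'Hom(g, 'End(V))) (mu : 'Hom(g, 'Hom(g, 'End(V)))).
Hypothesis rep : is_representation rho mu.
Local Notation D := (repD rho mu).

Lemma rho_equivariant x y a u :
  rho [ly x, y, a] u = D x y (rho a u) - rho a (D x y u).
Proof. by rewrite (rep_rho3 rep) add_lfunE opp_lfunE !comp_lfunE. Qed.

Lemma mu_equivariant x y a b u :
  mu [ly x, y, a] b u + mu a [ly x, y, b] u
  = D x y (mu a b u) - mu a b (D x y u).
Proof.
by rewrite -add_lfunE (rep_mu3 rep) add_lfunE opp_lfunE !comp_lfunE.
Qed.

End Equivariance.

(** * Actions: D as a derivation of the target *)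

Section Action.
Variables (K : fieldType) (g h : lieYamagutiType K).
Variables (rho : 'Hom(g, 'End(h))) (mu : 'Hom(g, 'Hom(g, 'End(h)))).
Hypothesis act : is_action rho mu.
Local Notation D := (repD rho mu).

Lemma action_repD_central x y u : central (D x y u).
Proof.
rewrite repDE; have cr := action_rho_central act.
have cm := action_mu_central act.
by do ![apply: centralD | apply: centralN].
Qed.

Lemma action_repD2 x y u v : D x y [ly u, v] = 0.
Proof.
by rewrite repDE !(action_mu2 act) !(action_rho2 act) !hom0 !(subr0, addr0).
Qed.

Lemma action_repD3 x y u v w : D x y [ly u, v, w] = 0.
Proof.
by rewrite repDE !(action_mu3 act) !(action_rho3 act) !hom0 !(subr0, addr0).
Qed.

(** The terms that mix a bracket of [h] with [rho] vanish, since [rho] kills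
    brackets and takes central values; the pure bracket terms collapse to
    [[ly H x, H y, u]] by the cyclic identity for [H x, H y, u]. *)
Lemma repD_rhoH_muH (H : 'Hom(g, h)) x y u : is_crossed_hom rho mu H ->
  repD (rhoH rho H) (muH mu H) x y u = [ly H x, H y, u] + D x y u.
Proof.
case=> H2 _.
have cr := action_rho_central act.
rewrite (repDE rho mu) repDE !muHE !rhoHE H2 !homE.
rewrite !(central_lybr2r _ (cr _ _)) !(central_lybr2l _ (cr _ _)).
rewrite !(action_rho2 act).
have -> : [ly H x, H y, u] = - ([ly [ly H x, H y], u] + [ly [ly H y, u], H x]
   + [ly [ly u, H x], H y] + [ly H y, u, H x] + [ly u, H x, H y]).
  apply/eqP; rewrite -addr_eq0 -(lybr_cyclic (H x) (H y) u); apply/eqP.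
  vring.
rewrite (lybr2_skew (H x) [ly H y, u]) (lybr2_skew (H y) [ly H x, u]).
rewrite (lybr2_skew (H x) u) !homE (lybr3_skew (H y) u).
vring.
Qed.

End Action.

(** * Infinitesimal symmetries *)

(** Here [(d, E)] is an infinitesimal symmetry of [g], [h] and the action; the
    lemmas linearise the two crossed homomorphism equations at [H] in the
    direction [H \o d - E \o H]. *)
Section InfinitesimalSymmetry.
Variables (K : fieldType) (g h : lieYamagutiType K).
Variables (rho : 'Hom(g, 'End(h))) (mu : 'Hom(g, 'Hom(g, 'End(h)))).
Variables (H : 'Hom(g, h)) (d : 'End(g)) (E : 'End(h)).
Hypothesis crossed : is_crossed_hom rho mu H.
Hypothesis d2 : forall a b, d [ly a, b] = [ly d a, b] + [ly a, d b].
Hypothesis d3 : forall a b c,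
  d [ly a, b, c] = [ly d a, b, c] + [ly a, d b, c] + [ly a, b, d c].
Hypothesis E2 : forall u v, E [ly u, v] = [ly E u, v] + [ly u, E v].
Hypothesis E3 : forall u v w,
  E [ly u, v, w] = [ly E u, v, w] + [ly u, E v, w] + [ly u, v, E w].
Hypothesis rho_d : forall a u, rho (d a) u = E (rho a u) - rho a (E u).
Hypothesis mu_d : forall a b u,
  mu (d a) b u + mu a (d b) u = E (mu a b u) - mu a b (E u).
Local Notation f := (fun z => H (d z) - E (H z)).

Lemma infinitesimal_symmetry_eq2 a b :
  f [ly a, b]
  = rho a (f b) - rho b (f a) + [ly f a, H b] + [ly H a, f b].
Proof.
case: crossed => H2 _.
rewrite /= d2 homD 3!H2 2!rho_d !homE E2.
vring.
Qed.

Lemma infinitesimal_symmetry_eq3 a b c :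
  f [ly a, b, c]
  = repD rho mu a b (f c) + mu b c (f a) - mu a c (f b)
    + [ly f a, H b, H c] + [ly H a, f b, H c] + [ly H a, H b, f c].
Proof.
have D_d := repD_symmetry d2 rho_d mu_d.
(* As a variable, [D] stays an atom when sums of linear maps are expanded. *)
case: crossed => _; move: (repD rho mu) D_d => D D_d H3.
rewrite /= d3 !homD 4!H3 !homE E3.
have -> : mu b (d c) (H a)
    = E (mu b c (H a)) - mu b c (E (H a)) - mu (d b) c (H a).
  by rewrite -mu_d; vring.
have -> : mu a (d c) (H b)
    = E (mu a c (H b)) - mu a c (E (H b)) - mu (d a) c (H b).
  by rewrite -mu_d; vring.
have -> : D a (d b) (H c)
    = E (D a b (H c)) - D a b (E (H c)) - D (d a) b (H c).
  by rewrite -D_d; vring.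
vring.
Qed.

End InfinitesimalSymmetry.

(** * The cocycle property of delta *)

(** Solve the ternary crossed homomorphism equation for its last three terms. *)
Lemma delta_symmetryE (K : fieldType) (g h : lieYamagutiType K)
    (rho : 'Hom(g, 'End(h))) (mu : 'Hom(g, 'Hom(g, 'End(h))))
    (H : 'Hom(g, h)) (crossed : is_crossed_hom rho mu H) x y z :
  delta mu H x y z = H [ly x, y, z] - repD rho mu x y (H z).
Proof. by case: crossed => _ ->; rewrite deltaE; vring. Qed.

Theorem proposition4p3 (K : fieldType) (char0 : [pchar K] =i pred0)
    (g h : lieYamagutiType K)
    (rho : 'Hom(g, 'End(h))) (mu : 'Hom(g, 'Hom(g, 'End(h))))
    (act : is_action rho mu)
    (H : 'Hom(g, h)) (crossed : is_crossed_hom rho mu H) :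
  forall x y : g, is_1cocycle (rhoH rho H) (muH mu H) (delta mu H x y).
Proof.
move=> x y; have rep := action_rep act.
have deltaL := delta_symmetryE crossed x y.
have Dc := action_repD_central act x y.
have d2 := @lybr3_der2 K g x y.
have d3 := @lybr3_der3 K g x y.
have E2 u v : repD rho mu x y [ly u, v]
    = [ly repD rho mu x y u, v] + [ly u, repD rho mu x y v].
  by rewrite action_repD2 // central_lybr2l // central_lybr2r // addr0.
have E3 u v w : repD rho mu x y [ly u, v, w]
    = [ly repD rho mu x y u, v, w] + [ly u, repD rho mu x y v, w]
      + [ly u, v, repD rho mu x y w].
  rewrite action_repD3 // central_lybr3l // central_lybr3m //.
  by rewrite central_lybr3r // !addr0.
have rho_d := rho_equivariant rep x y.
have mu_d := mu_equivariant rep x y.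
split=> [a b|a b c].
- have := infinitesimal_symmetry_eq2 crossed d2 E2 rho_d a b.
  rewrite /= -!deltaL => ->.
  rewrite !rhoHE (lybr2_skew (delta mu H x y a)).
  vring.
- have := infinitesimal_symmetry_eq3 crossed d2 d3 E3 rho_d mu_d a b c.
  rewrite /= -!deltaL => ->.
  rewrite (repD_rhoH_muH act) // !muHE (lybr3_skew (H a) (delta mu H x y b)).
  vring.
Qed.
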